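(* Let $X$ be an infinite, compact (Hausdorff) topological group with no elements of order two. (a) There exists a closed game subset $A$ for $X$ if and only if the space $X$ is totally disconnected and metrizable, i.e. it is a Cantor set. (b) If $A$ is a closed game subset for $X$, then the tournament $\widehat{A}$ is arc cyclic and so every point of $X$ is a cycle point for $\widehat A$.
   Context: All spaces are Hausdorff. A tournament on a nonempty set $X$ is a relation $R\subset X\times X$ with $R\cap R^{-1}=1_X=\{(x,x):x\in X\}$ and $R\cup R^{-1}=X\times X$. Its set of arcs is $R^\circ=R\setminus 1_X$. It is a topological tournament on a space $X$ when $R$ is closed in $X\times X$. A 3-cycle is a triple of distinct points with $(x_1,x_2),(x_2,x_3),(x_3,x_1)\in R^\circ$. The tournament is arc cyclic when for every arc $(x_1,x_2)\in R^\circ$ there is $x_3$ such that $\{x_1,x_2,x_3\}$ is a 3-cycle. A point $x$ is a cycle point when every neighborhood of $x$ contains a 3-cycle which includes $x$. For a group $X$ with identity $e$, a game subset is a subset $A\subset X$ with $A\cap A^{-1}=\{e\}$ and $A\cup A^{-1}=X$, where $A^{-1}=\{x^{-1}:x\in A\}$. The associated tournament on $X$ is $\widehat A=\{(x,y): x^{-1}y\in A\}$; if $X$ is a topological group and $A$ is closed then $\widehat A$ is a topological tournament. A Cantor set is a nonempty compact, metrizable, totally disconnected space with no isolated points. *)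

(* Defs.v *)
From HB Require Import structures.
From mathcomp Require Import all_boot all_order all_algebra.
From mathcomp Require Import all_classical reals topology.

Set Implicit Arguments.
Unset Strict Implicit.
Unset Printing Implicit Defensive.

Import Order.TTheory GRing.Theory Num.Theory.

Local Open Scope classical_set_scope.

HB.structure Definition PreTopologicalGroup :=
  {G of Topological G & Group G}.

HB.mixin Record PreTopologicalGroup_isTopologicalGroup G
    of PreTopologicalGroup G := {
  mulg_continuous : continuous (fun x : G * G => (x.1 * x.2)%g) ;
  invg_continuous : continuous (fun x : G => (x^-1)%g)
}.

(* The Hausdorff axiom is not part of this structure. *)
#[short(type="topologicalGroupType")]
HB.structure Definition TopologicalGroup :=
  {G of PreTopologicalGroup G & PreTopologicalGroup_isTopologicalGroup G}.

Section Spaces.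
Local Open Scope ring_scope.

Definition metrizable (K : realType) (T : topologicalType) : Prop :=
  exists d : T -> T -> K,
    [/\ forall x y, 0 <= d x y,
        forall x y, d x y = 0 <-> x = y,
        forall x y, d x y = d y x,
        forall x y z, d x z <= d x y + d y z &
        forall x : T, nbhs x = nbhs_ball_ (fun y e => [set z | d y z < e]) x].

Definition cantor_set (K : realType) (T : topologicalType) : Prop :=
  [/\ [set: T] !=set0,
      compact [set: T],
      metrizable K T,
      totally_disconnected [set: T] &
      isolated [set: T] = set0].

End Spaces.

Section Tournaments.
Local Open Scope relation_scope.

Definition tournament (T : Type) (R : set (T * T)) : Prop :=
  [/\ [set: T] !=set0, R `&` R^-1 = diagonal & R `|` R^-1 = [set: T * T]].

Definition topological_tournament (T : topologicalType) (R : set (T * T)) :=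
  tournament R /\ closed R.

Definition arcs (T : Type) (R : set (T * T)) : set (T * T) := R `\` diagonal.

Definition three_cycle (T : Type) (R : set (T * T)) (x1 x2 x3 : T) : Prop :=
  [/\ x1 <> x2, x2 <> x3 & x3 <> x1] /\
  [/\ arcs R (x1, x2), arcs R (x2, x3) & arcs R (x3, x1)].

(* When R is a tournament and (x1, x2) is an arc, a 3-cycle with vertices
   x1, x2, x3 can only be traversed as x1 -> x2 -> x3 -> x1. *)
Definition arc_cyclic (T : Type) (R : set (T * T)) : Prop :=
  forall x1 x2, arcs R (x1, x2) -> exists x3, three_cycle R x1 x2 x3.

Definition cycle_point (T : topologicalType) (R : set (T * T)) (x : T) : Prop :=
  forall U, nbhs x U -> exists x1 x2 x3,
    [/\ three_cycle R x1 x2 x3,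
        [set x1; x2; x3] `<=` U &
        [set x1; x2; x3] x].

End Tournaments.

Section Games.
Local Open Scope group_scope.

Definition order_two (G : groupType) (x : G) : Prop := x <> 1 /\ x ^+ 2 = 1.

Definition game_subset (G : groupType) (A : set G) : Prop :=
  A `&` [set x^-1 | x in A] = [set 1] /\ A `|` [set x^-1 | x in A] = [set: G].

Definition game_tournament (G : groupType) (A : set G) : set (G * G) :=
  [set xy | A (xy.1^-1 * xy.2)].

Lemma game_tournamentP (G : groupType) (A : set G) :
  game_subset A -> tournament (game_tournament A).
Proof.
move=> [AI AU]; have inA (z : G) : [set x^-1 | x in A] z <-> A z^-1.
  by split=> [[y Ay <-]|Az]; [rewrite invgK|exists z^-1; rewrite ?invgK].
have swap (x y : G) : (x^-1 * y)^-1 = y^-1 * x by rewrite invgM invgK.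
split; first by exists 1.
- apply/seteqP; split=> -[x y] /=.
  + move=> [Axy Ayx]; suff: [set 1] (x^-1 * y).
      by rewrite /diagonal /= => /mulg1_eq; rewrite invgK.
    by rewrite -AI; split=> //; apply/inA; rewrite swap.
  + rewrite /diagonal /= => ->; rewrite /game_tournament /= mulVg.
    have : [set 1] (1 : G) by [].
    by rewrite -AI => -[].
- apply/seteqP; split=> -[x y] //= _.
  have : [set: G] (x^-1 * y) by [].
  by rewrite -AU => -[Axy|/inA]; [left|rewrite swap; right].
Qed.

Lemma game_topological_tournament (G : topologicalGroupType) (A : set G) :
  game_subset A -> closed A -> topological_tournament (game_tournament A).
Proof.
move=> gA cA; split; first exact: game_tournamentP.
have div_continuous : continuous (fun xy : G * G => xy.1^-1 * xy.2).
  move=> z; apply: (@continuous_comp (G * G)%type (G * G)%type G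
    (fun xy => (xy.1^-1, xy.2)) (fun xy => xy.1 * xy.2)).
    apply: cvg_pair => /=; last exact: cvg_snd.
    apply: (@continuous_comp (G * G)%type G G fst); first exact: cvg_fst.
    exact: invg_continuous.
  exact: mulg_continuous.
exact: (preimage_closed (fun z _ => div_continuous z) cA).
Qed.

End Games.

(* Main.v *)
From HB Require Import structures.
Require Import Defs.
From mathcomp Require Import all_boot all_order all_algebra.
From mathcomp Require Import all_classical reals topology.

(** Write [e] for the identity.  Everything rests on two consequences of
compactness.

Powers.  In a compact group, [a^-1] is a limit of positive powers of [a]: two
powers [a^m], [a^n] with [m < n] that lie close together make [a^(n-m-1)] close
to [a^-1] ([closed_powers_inv]).  So a closed game subset [A] cannot contain
every power of one of its elements [a <> e], since it would then contain both
[a] and [a^-1].  In particular [a A] is not included in [A]: some [c] in [a A]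
lies outside [A], and [e -> a -> c -> e] is a 3-cycle.  By left invariance the
tournament is arc cyclic.  When [a] tends to [e], every limit of such [c] lies
in [A] and in its inverse, hence equals [e]; these cycles therefore shrink to
[e], and every point is a cycle point.

The same principle gives total disconnectedness.  Let [C] be the component of
[e].  Removing [e] from [C] leaves two disjoint relatively open pieces, the
traces of [A] and of its inverse, so [S = A] inter [C] is connected.  For
[a <> e] in [S], the connected set [a S] avoids [e] and meets [A], hence stays
in [A].  So [S] contains all powers of [a], which is absurd, and [C = {e}].

Limits of arcs.  For metrizability, choose neighborhoods [H_n] of [e] whose
intersection [N] is a closed subgroup, together with points [x_n <> e] of
[A] inter [H_n] such that [x_n H_(n+1)] is included in [A]; this is possible
because [A] is a neighborhood of [x_n].  A cluster point [z] of the [x_n] lies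
in [N], and [z N = N] is included in [A].  As [N] is symmetric, [N = {e}], and
[e] is a countable intersection of neighborhoods ([game_countable_nbhs1]).
Such an intersection is all that is needed of metrizability: refining it by
clopen sets [B_n], the relations 'every translate of [B_n] contains both or
neither of [x], [y]' are open equivalence relations that separate points, and
they define an ultrametric.

Conversely, in a totally disconnected compact group without elements of order
two, each [x <> e] is separated from [x^-1] by a clopen set.  The complement of
[e] is a countable union of compact sets, so countably many clopen sets [W_n],
each disjoint from its inverse, suffice to decide between [x] and [x^-1] for
every [x <> e].  Giving priority to the first [W_n] that decides yields an open
set [Q] for which the complement of [e] is the disjoint union of [Q] and its
inverse; adjoining [e] gives a closed game subset. *)

Import Order.TTheory GRing.Theory Num.Theory.

Set Implicit Arguments.
Unset Strict Implicit.
Unset Printing Implicit Defensive.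

Local Open Scope classical_set_scope.

(** * Compact spaces *)

(** The sets with complement (in [L]) satisfying [Q] form a filter; if [Q L]
failed it would be proper, and a cluster point would contradict the local
hypothesis.  This replaces extraction of finite subcovers below. *)
Lemma compact_ind (T : topologicalType) (L : set T) (Q : set T -> Prop) :
  compact L -> Q set0 ->
  (forall U V, U `<=` V -> Q V -> Q U) ->
  (forall U V, Q U -> Q V -> Q (U `|` V)) ->
  (forall x, L x -> exists2 U, nbhs x U & Q U) -> Q L.
Proof.
move=> cL Q0 Qsub QU Qloc; apply: contrapT => nQL.
pose F : set_system T := [set B | Q (L `\` B)].
have FF : ProperFilter F.
  split; first by rewrite /F /= setD0.
  split; rewrite /F /=.
  - by rewrite setDT.
  - by move=> B C QB QC; rewrite /= setDIr; exact: QU.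
  - by move=> B C BC; apply: Qsub => x [Lx nCx]; split=> // /BC.
have FL : F L by rewrite /F /= setDv.
have [x [Lx clx]] := cL F FF FL.
have [U Ux QUU] := Qloc x Lx.
have FU : F (L `\` U).
  by apply: Qsub QUU => y [Ly]; apply: contra_notP => nUy; split.
by have [y [[_ nUy] Uy]] := clx _ _ FU Ux.
Qed.

Lemma compact_seq_cluster (T : topologicalType) (u : nat -> T) :
  compact [set: T] ->
  exists z : T, forall B, nbhs z B -> forall n, exists2 m, (n <= m)%N & B (u m).
Proof.
move=> cT; have [|z [_ clz]] := cT (u @ \oo) _; first exact: filterT.
exists z => B Bz n.
have Fn : (u @ \oo) [set x | exists2 m, (n <= m)%N & u m = x].
  by exists n => // m nm; exists m.
by have [_ [[m nm <-] Bm]] := clz _ _ Fn Bz; exists m.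
Qed.

Lemma closed_compactT (T : topologicalType) (A : set T) :
  compact [set: T] -> closed A -> compact A.
Proof. by move=> cT cA; apply: subclosed_compact cA cT _. Qed.

(** * Totally disconnected compact spaces are zero-dimensional *)

Section quasi_components.
Variable T : topologicalType.
Hypotheses (cT : compact [set: T]) (hT : hausdorff_space T).

Let quasi (x : T) : set T := \bigcap_(U in [set U | clopen U /\ U x]) U.

(** The clopen sets containing [x] are stable under intersection, so by
compactness one of them already enters [O]. *)
Let quasi_nbhs x O : open O -> quasi x `<=` O ->
  exists U, [/\ clopen U, U x & U `<=` O].
Proof.
move=> oO QO.
have [U [clU Ux UO]] : exists U, [/\ clopen U, U x & U `&` ~` O = set0].
  apply: (@compact_ind _ (~` O) (fun L =>
    exists U, [/\ clopen U, U x & U `&` L = set0])).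
  - exact/(closed_compactT cT)/open_closedC.
  - by exists setT; split=> //; [exact: clopenT|rewrite setI0].
  - move=> L M LM [U [cU Ux UM]]; exists U; split=> //.
    by rewrite -subset0 -UM => y [Uy /LM].
  - move=> L M [U [cU Ux UL]] [V [cV Vx VM]]; exists (U `&` V); split=> //.
      exact: clopenI.
    rewrite -subset0 => y [[Uy Vy] [Ly|My]]; first by rewrite -UL.
    by rewrite -VM.
  - move=> y Oy; have [U [[cU Ux] nUy]] : exists U, (clopen U /\ U x) /\ ~ U y.
      apply: contrapT => nex; apply/Oy/QO => U [cU Ux].
      by apply: contrapT => nUy; apply: nex; exists U.
    exists (~` U); last by exists U; split=> //; rewrite setICr.
    by apply: open_nbhs_nbhs; split=> //; case: (clopenC setT cU).
exists U; split=> // y Uy; apply: contrapT => nOy.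
by rewrite -[False]/(set0 y) -UO.
Qed.

(** A splitting of the quasi-component into two closed pieces extends, by
normality, to disjoint open sets [O1] and [O2]; a clopen neighborhood of [x]
inside their union is cut by them into two clopen sets, only one of which
contains [x]. *)
Let quasi_connected x : connected (quasi x).
Proof.
have Qx : quasi x x by move=> U [].
have cQ : closed (quasi x) by apply: closed_bigI => U [[]].
move=> B [b Bb] [C oC BC] [D cD BD].
have cB : closed B by rewrite BD; exact: closedI.
have cB' : closed (quasi x `&` ~` C).
  by apply: closedI => //; exact: open_closedC.
have Bsep : set_nbhs B (~` (quasi x `&` ~` C)).
  move=> y; rewrite BC => -[Qy Cy].
  by apply: open_nbhs_nbhs; split; [exact: closed_openC|case].
have [i Bi clO1] := compact_normal hT cT cB Bsep.
pose O1 := i°; have oO1 : open O1 by exact: open_interior.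
have BO1 : B `<=` O1 := Bi.
have O1i : O1 `<=` i by exact: interior_subset.
pose O2 := ~` closure i.
have oO2 : open O2 by apply: closed_openC; exact: closed_closure.
have O12 y : O1 y -> O2 y -> False by move=> /O1i /subset_closure.
have QO : quasi x `<=` O1 `|` O2.
  move=> y Qy; have [Cy|nCy] := pselect (C y); [left|right].
    by apply: BO1; rewrite BC.
  by move=> /clO1; apply.
have [U [[oU cU] Ux UO]] := quasi_nbhs (openU oO1 oO2) QO.
have UO1 : clopen (U `&` O1).
  split; first exact: openI.
  suff -> : U `&` O1 = U `&` ~` O2 by apply: closedI => //; exact: open_closedC.
  apply/seteqP; split=> y [Uy Oy]; split=> //; first by move=> /(O12 _ Oy).
  by case: (UO _ Uy).
have UO2 : clopen (U `&` O2).
  split; first exact: openI.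
  suff -> : U `&` O2 = U `&` ~` O1 by apply: closedI => //; exact: open_closedC.
  apply/seteqP; split=> y [Uy Oy]; split=> //; first by move=> /O12; apply.
  by case: (UO _ Uy).
have [O1x|O2x] := UO _ Ux.
  apply/seteqP; split=> y; first by rewrite BC => -[].
  move=> Qy; have [_ O1y] := Qy _ (conj UO1 (conj Ux O1x)).
  rewrite BC; split=> //; apply: contrapT => nCy.
  by apply: (clO1 y); [exact/subset_closure/O1i|].
have Qb : quasi x b by move: Bb; rewrite BC => -[].
have [_ O2b] := Qb _ (conj UO2 (conj Ux O2x)).
by case: (O12 b (BO1 _ Bb) O2b).
Qed.

Lemma totally_disconnected_zero_dimensional :
  totally_disconnected [set: T] -> zero_dimensional T.
Proof.
move=> tdT x y /eqP xy; apply: contrapT => nsep; apply: xy.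
suff Qy : quasi x y.
  have : connected_component setT x y.
    by apply: (@connected_component_max _ _ (quasi x)) => // U [].
  by rewrite tdT.
by move=> U [cU Ux]; apply: contrapT => nUy; apply: nsep; exists U.
Qed.

End quasi_components.

(** * Metrizability *)

Lemma metrizable_countable_nbhs (K : realType) (T : topologicalType) (x : T) :
  metrizable K T -> exists V : nat -> set T,
    (forall n, nbhs x (V n)) /\ forall y, (forall n, V n y) -> y = x.
Proof.
move=> [d [d0 dE _ _ dN]].
exists (fun n => [set y | (d x y < n.+1%:R^-1)%R]); split=> [n|y Vy].
  by rewrite dN; exists n.+1%:R^-1%R => //=; rewrite invr_gt0 ltr0n.
apply/esym/dE/eqP; rewrite eq_le d0 andbT leNgt; apply/negP => dxy.
have [n] := ltr_add_invr dxy; rewrite add0r => /(lt_trans (Vy n)).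
by rewrite ltxx.
Qed.

(** A countable separating family of open equivalence relations metrizes a
compact space: take [1 / (n + 1)], with [n] the first relation that tells two
points apart.  No nesting of the relations is required for this to be an
ultrametric. *)
Section separating_equivalences.
Variables (K : realType) (T : topologicalType) (E : nat -> T -> T -> Prop).
Hypotheses (cT : compact [set: T])
  (Erefl : forall n x, E n x x) (Esym : forall n x y, E n x y -> E n y x)
  (Etrans : forall n x y z, E n x y -> E n y z -> E n x z)
  (Eopen : forall n x, nbhs x [set y | E n x y])
  (Esep : forall x y, (forall n, E n x y) -> x = y).

Local Open Scope ring_scope.

Let differ x y n := `[< ~ E n x y >].

Let dist (x y : T) : K :=
  if pselect (exists n, differ x y n) is left ex
  then (ex_minn ex).+1%:R^-1 else 0.

Let dist_le n x y : ~ E n x y -> n.+1%:R^-1 <= dist x y.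
Proof.
move=> nE; rewrite /dist; case: pselect => [ex|[]]; last first.
  by exists n; apply/asboolP.
case: ex_minnP => m _ /(_ n) mn; rewrite lef_pV2 ?posrE ?ltr0n// ler_nat ltnS.
by apply: mn; apply/asboolP.
Qed.

Let dist_ge0 x y : 0 <= dist x y.
Proof. by rewrite /dist; case: pselect => // ex; rewrite invr_ge0 ler0n. Qed.

Let dist_cases x y : (x = y /\ dist x y = 0) \/
  exists n, [/\ ~ E n x y, dist x y = n.+1%:R^-1 &
    forall m, (m < n)%N -> E m x y].
Proof.
rewrite /dist; case: pselect => [ex|nex]; [right|left].
  case: ex_minnP => n /asboolP nE mn; exists n; split=> // m mlt.
  apply: contrapT => nEm; move: mlt; rewrite ltnNge => /negP; apply.
  by apply: mn; apply/asboolP.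
split=> //; apply: Esep => n; apply: contrapT => nE; apply: nex.
by exists n; apply/asboolP.
Qed.

Let dist_ball_nbhs x e : 0 < e -> nbhs x [set y | dist x y < e].
Proof.
move=> e0; have [n] := ltr_add_invr e0; rewrite add0r => ne.
have : nbhs x [set y | forall m, (m < n)%N -> E m x y].
  elim: (n) => [|k IHk].
    by apply: (@filterS _ (nbhs x) _ setT) => //; exact: filterT.
  apply: filterS (filterI IHk (Eopen k x)) => y [IH Ek] m.
  by rewrite ltnS leq_eqVlt => /predU1P[->//|]; exact: IH.
apply: filterS => y /= Ey; have [[_ ->]//|[k [nEk -> _]]] := dist_cases x y.
apply: le_lt_trans ne; rewrite lef_pV2 ?posrE ?ltr0n// ler_nat ltnS leqNgt.
by apply/negP => /Ey.
Qed.

Let nbhs_dist_ball x U : nbhs x U -> exists2 e, 0 < e &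
  [set y | dist x y < e] `<=` U.
Proof.
move=> Ux.
have : exists2 e, 0 < e & forall y, (~` U°) y -> e <= dist x y.
  apply: (@compact_ind _ (~` U°) (fun L => exists2 e, 0 < e &
      forall y, L y -> e <= dist x y)).
  - by apply: closed_compactT => //; apply: open_closedC; exact: open_interior.
  - by exists 1.
  - by move=> L M LM [e e0 eM]; exists e => // y /LM; exact: eM.
  - move=> L M [e e0 eL] [f f0 fM]; exists (Num.min e f).
      by rewrite lt_min e0.
    by move=> y [/eL|/fM]; rewrite ge_min => ->; rewrite ?orbT.
  - move=> y nUy; have [n nE] : exists n, ~ E n x y.
      apply: contrapT => nex; apply: nUy.
      suff <- : x = y by exact: nbhs_singleton (nbhs_interior Ux).
      by apply: Esep => n; apply: contrapT => nE; apply: nex; exists n.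
    exists [set z | E n y z] => //; exists n.+1%:R^-1.
      by rewrite invr_gt0 ltr0n.
    move=> z Eyz; apply: dist_le => Exz; apply: nE.
    exact: Etrans Exz (Esym Eyz).
move=> [e e0 eU]; exists e => // y /= dxy; apply: contrapT => nUy.
have := eU y (fun Uy => nUy (interior_subset Uy)).
by rewrite leNgt dxy.
Qed.

Lemma separating_equivalences_metrizable : metrizable K T.
Proof.
exists dist; split=> //.
- move=> x y; split=> [|->].
    have [[]//|[n [_ -> _]]] := dist_cases x y.
    by move=> /eqP; rewrite invr_eq0 pnatr_eq0.
  by have [[]//|[n []]] := dist_cases y y.
- move=> x y; have le u v : dist u v <= dist v u.
    have [[_ ->]//|[n [nE -> _]]] := dist_cases u v.
    by apply: dist_le => /Esym.
  by apply/eqP; rewrite eq_le !le.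
- move=> x y z; have [[_ ->]|[n [nE -> _]]] := dist_cases x z.
    by rewrite addr_ge0.
  have [Exy|nExy] := pselect (E n x y); last first.
    by rewrite -[leLHS]addr0 lerD // dist_le.
  by rewrite -[leLHS]add0r lerD // dist_le // => /(Etrans Exy).
- move=> x; apply/seteqP; split=> U.
    by move=> /nbhs_dist_ball [e e0 eU]; exists e.
  by move=> [e /= e0 eU]; apply: filterS eU _; exact: dist_ball_nbhs.
Qed.

End separating_equivalences.

(** * Compact topological groups *)

Section topological_groups.
Local Open Scope group_scope.
Variable X : topologicalGroupType.
Implicit Types (x y z : X) (A U V W : set X).

Lemma near_mulg x y U : nbhs (x * y) U ->
  exists V W, [/\ nbhs x V, nbhs y W & forall v w, V v -> W w -> U (v * w)].
Proof.
move=> /(@mulg_continuous X (x, y)) [[V W] [/= Vx Wy] VWU].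
by exists V, W; split=> // v w Vv Ww; exact: (VWU (v, w)).
Qed.

Lemma near_mulgl a x U : nbhs (a * x) U -> nbhs x [set y | U (a * y)].
Proof.
move=> /near_mulg [V [W [Va Wx VW]]]; apply: filterS Wx => w Ww.
exact: VW (nbhs_singleton Va) Ww.
Qed.

Lemma near_mulgr a x U : nbhs (x * a) U -> nbhs x [set y | U (y * a)].
Proof.
move=> /near_mulg [V [W [Vx Wa VW]]]; apply: filterS Vx => w Ww.
exact: VW Ww (nbhs_singleton Wa).
Qed.

Lemma near_invg x U : nbhs x^-1 U -> nbhs x [set y | U y^-1].
Proof. exact: invg_continuous. Qed.

Lemma near1_mulgl x U : nbhs x U -> nbhs 1 [set y | U (x * y)].
Proof. by move=> Ux; apply: near_mulgl; rewrite mulg1. Qed.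

Lemma mulgl_continuous a : continuous (fun x => a * x).
Proof. by move=> x U; exact: near_mulgl. Qed.

Lemma near_divg x U : nbhs 1 U ->
  exists2 V, nbhs x V & forall v w, V v -> V w -> U (v^-1 * w).
Proof.
rewrite -(mulVg x) => /near_mulg [V [W [Vx Wx VW]]].
exists ([set y | V y^-1] `&` W).
  by apply: filterI => //; exact: near_invg.
by move=> v w [Vv _] [_ Ww]; exact: VW.
Qed.

Lemma near1_divg U : nbhs 1 U ->
  exists2 V, nbhs 1 V & forall v w, V v -> V w -> U (v * w^-1).
Proof.
move=> U1; have := U1; rewrite -{1}(mulg1 1) => /near_mulg [V [W [V1 W1 VW]]].
exists (V `&` [set y | W y^-1]).
  by apply: filterI => //; apply: near_invg; rewrite invg1.
by move=> v w [Vv _] [_ Ww]; exact: VW.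
Qed.

Lemma closed_invg A : closed A -> closed [set x | A x^-1].
Proof.
by apply: preimage_closed => x _; exact: invg_continuous.
Qed.

Lemma open_invg A : open A -> open [set x | A x^-1].
Proof. exact: (continuousP _).1 (@invg_continuous X) A. Qed.

Lemma clopen_invg A : clopen A -> clopen [set x | A x^-1].
Proof. by move=> [oA cA]; split; [exact: open_invg|exact: closed_invg]. Qed.

Hypothesis cX : compact [set: X].

(** A cluster point of the powers of [a] has two powers [a ^+ m], [a ^+ n] with
[m < n] close to it, so that [a ^+ (n - m - 1)] is close to [a^-1]. *)
Lemma closed_powers_inv A a : closed A -> (forall n, A (a ^+ n)) -> A a^-1.
Proof.
move=> cA Aa; apply: contrapT => nAV.
have nA1 : nbhs 1 [set x | ~ A (x * a^-1)].
  apply: (@near_mulgr a^-1 1 (~` A)); rewrite mul1g.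
  by apply: open_nbhs_nbhs; split=> //; exact: closed_openC.
have [z clz] := compact_seq_cluster (fun n => a ^+ n) cX.
have [V Vz VV] := near_divg z nA1.
have [m _ Vm] := clz _ Vz 0.
have [n mn Vn] := clz _ Vz m.+1.
apply: VV Vm Vn _.
rewrite (_ : n = (m + (n - m.+1).+1)%N); last by rewrite addnS -addSn subnKC.
by rewrite expgnDr mulKg expgSr mulgK.
Qed.

Lemma infinite_nbhs1 U : infinite_set [set: X] -> nbhs 1 U ->
  exists2 x, U x & x <> 1.
Proof.
move=> iX U1; apply: contrapT => nex; apply: iX.
apply: (@compact_ind _ _ finite_set) => //.
  by move=> A B /sub_finite_set; apply.
  by move=> A B; rewrite finite_setU.
move=> x _; exists [set x]; last exact: finite_set1.
have : nbhs x [set y | U (x^-1 * y)] by apply: near_mulgl; rewrite mulVg.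
apply: filterS => y /= Uy; apply: contrapT => yx; apply: nex.
exists (x^-1 * y) => // /mulg1_eq; rewrite invgK => /esym; exact: yx.
Qed.

Lemma isolated_infinite : infinite_set [set: X] -> isolated [set: X] = set0.
Proof.
move=> iX; rewrite -subset0 => x [_ [V Vx]]; rewrite setIT => Vx1.
have [y Vy] := infinite_nbhs1 iX (near1_mulgl Vx); apply.
have : V (x * y) by []; rewrite Vx1 => /= /(canRL (mulKg x)).
by rewrite mulVg.
Qed.

(** * Closed game subsets and their cycles *)

Section game.
Variables (A : set X).
Hypotheses (gA : game_subset A) (cA : closed A).

Let A1 : A 1.
Proof.
by have [AI _] := gA; have : [set (1 : X)] 1 by []; rewrite -AI => -[].
Qed.

Let game_inv x : A x -> A x^-1 -> x = 1.
Proof.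
move=> Ax Ax'; have [AI _] := gA.
suff : [set (1 : X)] x by [].
by rewrite -AI; split=> //; exists x^-1 => //; rewrite invgK.
Qed.

Let game_total x : ~ A x -> A x^-1.
Proof.
have [_ AU] := gA; have : [set: X] x by []; rewrite -AU => -[//|[y Ay <- _]].
by rewrite invgK.
Qed.

(** Away from the identity, [A] is the complement of the closed set of inverses
of its elements. *)
Let game_open x : A x -> x <> 1 -> nbhs x A.
Proof.
move=> Ax x1; have : nbhs x (~` [set y | A y^-1]).
  apply: open_nbhs_nbhs; split; first exact/closed_openC/(closed_invg cA).
  by move=> Ax'; apply: x1; exact: game_inv.
by apply: filterS => y /= nAy; rewrite -(invgK y); exact: game_total.
Qed.

Lemma game_no_translation a : A a -> a <> 1 -> exists2 b, A b & ~ A (a * b).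
Proof.
move=> Aa a1; apply: contrapT => nex; apply: a1; apply: game_inv => //.
apply: closed_powers_inv => // n; elim: n => [|n IHn]; first by rewrite expg0.
by rewrite expgS; apply: contrapT => nAn; apply: nex; exists (a ^+ n).
Qed.

(** The cycle [1, a, c] in normalized form; [c] is the translate [a * b] that
leaves [A]. *)
Lemma game_cycle a : A a -> a <> 1 ->
  exists c, [/\ c <> 1, a <> c, A c^-1 & A (a^-1 * c)].
Proof.
move=> Aa a1; have [b Ab nAb] := game_no_translation Aa a1.
exists (a * b); split; first by move=> E; apply: nAb; rewrite E.
- by move=> E; apply: nAb; rewrite -E.
- exact: game_total.
- by rewrite mulKg.
Qed.

Lemma game_three_cycle x a c : A a -> a <> 1 -> c <> 1 -> a <> c -> A c^-1 ->
  A (a^-1 * c) -> three_cycle (game_tournament A) x (x * a) (x * c).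
Proof.
move=> Aa a1 c1 ac Ac Aac.
have xa : x <> x * a by move=> E; apply: a1; apply: (mulgI x); rewrite -E mulg1.
have xc : x * c <> x by move=> E; apply: c1; apply: (mulgI x); rewrite E mulg1.
have xac : x * a <> x * c by move=> /mulgI.
rewrite /three_cycle /arcs /game_tournament /diagonal /=.
split; split=> //; split=> //=.
- by rewrite mulKg.
- by rewrite invgM -mulgA mulKg.
- by rewrite invgM -mulgA mulVg mulg1.
Qed.

Lemma game_arc_cyclic : arc_cyclic (game_tournament A).
Proof.
move=> x y [Aa xy]; rewrite /game_tournament /= in Aa.
have a1 : x^-1 * y <> 1 by move=> /mulg1_eq; rewrite invgK.
have [c [c1 ac Ac Aac]] := game_cycle Aa a1.
exists (x * c); have := game_three_cycle x Aa a1 c1 ac Ac Aac.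
by rewrite mulVKg.
Qed.

(** As [a] tends to [1], a limit of points [c] as below lies in [A] and in its
inverse, so the third vertex of a cycle through the arc from [1] to [a] is
forced towards [1]. *)
Lemma game_small_cycles W : nbhs 1 W ->
  exists2 H, nbhs 1 H & forall a c, H a -> A c^-1 -> A (a^-1 * c) -> W c.
Proof.
move=> W1.
have [H H1 HW] : exists2 H, nbhs 1 H &
    forall a c, H a -> (~` W°) c -> A c^-1 -> ~ A (a^-1 * c).
  apply: (@compact_ind _ (~` W°) (fun L => exists2 H, nbhs 1 H &
     forall a c, H a -> L c -> A c^-1 -> ~ A (a^-1 * c))).
  - by apply: closed_compactT => //; apply: open_closedC; exact: open_interior.
  - by exists setT => //; exact: filterT.
  - by move=> L M LM [H H1 HM]; exists H => // a c Ha /LM; exact: HM.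
  - move=> L M [H H1 HL] [H' H1' HM]; exists (H `&` H'); first exact: filterI.
    by move=> a c [Ha Ha'] [Lc|Mc]; [exact: HL|exact: HM].
  - move=> c Wc; have [Ac|nAc] := pselect (A c).
      exists [set x | ~ A x^-1].
        apply: open_nbhs_nbhs; split; first exact/closed_openC/(closed_invg cA).
        move=> Ac'; apply: Wc; rewrite (game_inv Ac Ac').
        exact: nbhs_singleton (nbhs_interior W1).
      by exists setT => //; exact: filterT.
    have : nbhs (1^-1 * c) (~` A).
      by rewrite invg1 mul1g; apply: open_nbhs_nbhs; split=> //;
        exact: closed_openC.
    move=> /near_mulg [V [U [V1 Uc VU]]].
    exists U => //; exists [set y | V y^-1]; first exact: near_invg.
    by move=> a b Va Ub _; exact: VU.
exists H => // a c Ha Ac Aac; apply: contrapT => nWc.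
by apply: (HW a c Ha _ Ac Aac) => /interior_subset.
Qed.

Lemma game_near1 W : infinite_set [set: X] -> nbhs 1 W ->
  exists2 a, A a /\ a <> 1 & W a.
Proof.
move=> iX W1; have := @infinite_nbhs1 (W `&` [set y | W y^-1]) iX.
case; first by apply: filterI => //; apply: near_invg; rewrite invg1.
move=> x [Wx Wx'] x1; have [Ax|nAx] := pselect (A x).
  by exists x.
exists x^-1 => //; split; first exact: game_total.
by move=> E; apply: x1; rewrite -(invgK x) E invg1.
Qed.

Lemma game_cycle_point x : infinite_set [set: X] ->
  cycle_point (game_tournament A) x.
Proof.
move=> iX U Ux; have W1 := near1_mulgl Ux.
have [H H1 HW] := game_small_cycles W1.
have [a [Aa a1] [Ha Ua]] := game_near1 iX (filterI H1 W1).
have [c [c1 ac Ac Aac]] := game_cycle Aa a1.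
exists x, (x * a), (x * c); split; first exact: game_three_cycle.
  move=> y [[->|->]|->] //; first exact: nbhs_singleton.
  exact: HW Ha Ac Aac.
by left; left.
Qed.

(** * A closed game subset forces total disconnectedness *)

Let C0 : set X := connected_component [set: X] 1.

Let component_translate a x y : connected_component [set: X] x y ->
  connected_component [set: X] (a * x) (a * y).
Proof.
move=> [B [Bx _ cB] By].
apply: (@connected_component_max _ _ [set a * z | z in B]) => //.
- by exists x.
- apply: connected_continuous_connected => //.
  exact/continuous_subspaceT/mulgl_continuous.
- by exists y.
Qed.

Let component_mulg a y : C0 a -> C0 y -> C0 (a * y).
Proof.
move=> Ca /(component_translate a); rewrite mulg1.
exact: connected_component_trans.
Qed.

(** Removing the cut point [1] from the connected set [C0] leaves two relatively
open pieces; either of them, with the cut point put back, is connected. *)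
Let game_component_connected : connected (A `&` C0).
Proof.
have C01 : C0 1 by exact: connected_component_refl.
have noB B : B !=set0 -> (exists2 C, open C & B = A `&` C0 `&` C) ->
    (exists2 C, closed C & B = A `&` C0 `&` C) -> B 1.
  move=> B0 [U oU BU] [D cD BD]; apply: contrapT => nB1.
  (* Missing the cut point makes [B] relatively open in [C0], since [A] is a
     neighborhood of each of its other points. *)
  have C0B : B = C0.
    apply: (@component_connected X setT 1) => //.
      exists (A° `&` U); first by apply: openI => //; exact: open_interior.
      rewrite BU; apply/seteqP; split=> y.
        move=> [[Ay Cy] Uy]; split=> //; split=> //; apply: game_open => // y1.
        by apply: nB1; rewrite BU -y1.
      by move=> [Cy [/interior_subset Ay Uy]].
    exists (A `&` D); first exact: closedI.
    by rewrite BD setICA setIA.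
  by apply: nB1; rewrite C0B.
move=> B B0 /[dup] oB [U oU BU] /[dup] cB [D cD BD].
have B1 := noB B B0 oB cB.
apply: contrapT => nBS.
have [y [Sy nBy]] : exists y, (A `&` C0) y /\ ~ B y.
  apply: contrapT => nex; apply: nBS; apply/seteqP; split=> y.
    by rewrite BU => -[].
  by move=> Sy; apply: contrapT => nBy; apply: nex; exists y.
have : (A `&` C0 `\` B) 1; last by case.
apply: noB; first by exists y.
- exists (~` D); first exact: closed_openC.
  by rewrite BD setDE setCI setIUr setICr set0U.
- exists (~` U); first exact: open_closedC.
  by rewrite BU setDE setCI setIUr setICr set0U.
Qed.

(** The translate of the connected set by [a] starts in [A] and avoids [1], the
only point through which it could leave [A]. *)
Let game_component_mull a : A a -> C0 a -> a <> 1 ->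
  forall y, A y -> C0 y -> A (a * y) /\ C0 (a * y).
Proof.
move=> Aa Ca a1 y Ay Cy; have Cay : C0 (a * y).
  exact: component_mulg.
split=> //.
pose aS := [set a * s | s in A `&` C0].
have caS : connected aS.
  apply: connected_continuous_connected => //.
  exact/continuous_subspaceT/mulgl_continuous.
have naS1 s : A s -> a * s <> 1.
  move=> As /mulg1_eq E; apply: a1; apply: game_inv => //; by rewrite E.
suff : aS `&` A = aS.
  by move=> E; have : aS (a * y) by [exists y]; rewrite -E => -[].
apply: caS.
- exists a; split=> //; exists 1; rewrite ?mulg1 //; split=> //.
  exact: connected_component_refl.
- exists A°; first exact: open_interior.
  apply/seteqP; split=> _ [[s [As Cs] <-]] Aas; split=> //; first by exists s.
  + by apply: game_open => //; exact: naS1.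
  + by exists s.
  + exact: interior_subset.
- by exists A.
Qed.

Lemma game_totally_disconnected : totally_disconnected [set: X].
Proof.
have C1 x : C0 x -> A x -> x = 1.
  move=> Cx Ax; apply: contrapT => x1.
  have C01 : C0 1 by exact: connected_component_refl.
  apply/x1/game_inv => //; apply: closed_powers_inv => // n.
  suff : A (x ^+ n) /\ C0 (x ^+ n) by case.
  elim: n => [|n [IA IC]]; first by rewrite expg0.
  by rewrite expgS; exact: game_component_mull.
have C0_1 x : C0 x -> x = 1.
  move=> Cx; have [Ax|nAx] := pselect (A x); first exact: C1.
  rewrite -(invgK x) (C1 x^-1) ?invg1 //; last exact: game_total.
  have /(component_translate x^-1) := Cx; rewrite mulg1 mulVg.
  exact: connected_component_sym.
move=> x _; apply/seteqP; split=> [y Cxy|y ->]; last first.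
  exact: connected_component_refl.
have /mulg1_eq : x^-1 * y = 1; last by rewrite invgK.
by apply: C0_1; rewrite /C0 -(mulVg x); exact: component_translate.
Qed.

(** * A closed game subset makes the identity a countable intersection *)

(** The neighborhoods are chosen so that their intersection [N] is a closed
subgroup and so that a sequence in [A] tending to [N] carries [N] into [A]; a
subgroup inside [A] is trivial, because it is symmetric. *)
Lemma game_countable_nbhs1 : infinite_set [set: X] ->
  exists V : nat -> set X,
    (forall n, nbhs 1 (V n)) /\ forall x, (forall n, V n x) -> x = 1.
Proof.
move=> iX.
have step (H : set X) : exists p : X * set X, nbhs 1 H ->
    [/\ A p.1, H p.1, nbhs 1 p.2, (forall a b, p.2 a -> p.2 b -> H (a * b^-1)) &
        forall b, p.2 b -> A (p.1 * b)].
  have [H1|nH1] := pselect (nbhs 1 H); last by exists (1, H).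
  have [a [Aa a1] Ha] := game_near1 iX H1.
  have [V V1 VH] := near1_divg H1.
  exists (a, V `&` [set b | A (a * b)]) => _; split=> //=.
  - by apply: filterI => //; apply: near1_mulgl; exact: game_open.
  - by move=> b c [Vb _] [Vc _]; exact: VH.
  - by move=> b [].
have [f fP] := choice step.
pose H n := iter n (fun V => (f V).2) setT; pose u n := (f (H n)).1.
have H1 n : nbhs 1 (H n).
  by elim: n => [|n IHn]; [exact: filterT|have [] := fP _ IHn].
have Hdiv n a b : H n.+1 a -> H n.+1 b -> H n (a * b^-1).
  by have [_ _ _ + _] := fP _ (H1 n); apply.
have Hu n : H n (u n) by have [] := fP _ (H1 n).
have Au n b : H n.+1 b -> A (u n * b).
  by have [_ _ _ _] := fP _ (H1 n); apply.
have Hle m n : (m <= n)%N -> H n `<=` H m.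
  move=> /subnK <-; elim: (n - m)%N => [//|k IHk] x Hx.
  apply: IHk; rewrite -(mulg1 x) -invg1; apply: Hdiv => //.
  exact: nbhs_singleton.
have [z clz] := compact_seq_cluster u cX.
(* [H n] contains the closure of [H n.+1]. *)
have Hz n : H n z.
  have zH : nbhs z [set w | H n.+1 (z^-1 * w)].
    by apply: near_mulgl; rewrite mulVg.
  have [m nm Hm] := clz _ zH n.+1.
  rewrite -(mulVKg (u m) z) -[_ * z]invgK invgM invgK.
  by apply: Hdiv => //; exact: Hle (Hu m).
pose N := \bigcap_n H n.
have Ndiv a b : N a -> N b -> N (a * b^-1).
  by move=> Na Nb n _; apply: Hdiv; [exact: Na|exact: Nb].
have zN y : N y -> A (z * y).
  move=> Ny; apply: contrapT => nA.
  have : nbhs z [set w | (~` A) (w * y)].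
    apply: near_mulgr; apply: open_nbhs_nbhs; split=> //; exact: closed_openC.
  by move=> /clz /(_ 0) [m _]; apply; apply: Au; exact: Ny.
have Nz : N z by move=> n _; exact: Hz.
have N1 : N 1 by move=> n _; exact: nbhs_singleton.
have NV y : N y -> N y^-1 by move=> Ny; rewrite -(mul1g y^-1); exact: Ndiv.
have NA y : N y -> A y.
  move=> Ny; rewrite -(mulVKg z y); apply: zN; rewrite -(invgK y).
  by apply: Ndiv; exact: NV.
exists H; split=> // x Hx; have Nx : N x by move=> n _; exact: Hx.
by apply: game_inv; apply: NA => //; exact: NV.
Qed.

End game.

(** * Construction of closed game subsets *)

Definition antisymmetric_set (P : set X) := forall x, P x -> ~ P x^-1.

(** Where [P] and [W] choose differently between [x] and [x^-1], [P] has
priority, so that antisymmetry is kept. *)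
Definition merge (P W : set X) :=
  P `|` (W `&` ~` (P `|` [set x | P x^-1])).

Definition covers (P : set X) x := P x \/ P x^-1.

Lemma merge_antisymmetric P W : antisymmetric_set P -> antisymmetric_set W ->
  antisymmetric_set (merge P W).
Proof.
move=> aP aW x [Px|[Wx nPx]] [Px'|[Wx' nPx']].
- exact: aP Px Px'.
- by apply: nPx'; right; rewrite /= invgK.
- by apply: nPx; right.
- exact: aW Wx Wx'.
Qed.

Lemma merge_clopen P W : clopen P -> clopen W -> clopen (merge P W).
Proof.
move=> cP cW; apply: clopenU => //; apply: clopenI => //.
by apply: (clopenC setT); apply: clopenU => //; exact: clopen_invg.
Qed.

Lemma merge_coversr P W x : covers W x -> covers (merge P W) x.
Proof.
have H y : W y -> covers (merge P W) y.
  move=> Wy; have [[Py|Py]|nPy] := pselect ((P `|` [set x | P x^-1]) y).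
  - by left; left.
  - by right; left.
  - by left; right.
by move=> [/H //|/H [|]]; [right|rewrite invgK; left].
Qed.

Lemma merge_coversl P W x : covers P x -> covers (merge P W) x.
Proof. by move=> [Px|Px]; [left|right]; left. Qed.

Hypothesis zX : zero_dimensional X.
Hypothesis no2 : forall x : X, ~ order_two x.

(** Locally, a clopen set containing [x] but not [x^-1], minus its inverse, does
the job; finitely many of these are merged. *)
Lemma compact_antisymmetric_cover (L : set X) : compact L -> ~ L 1 ->
  exists P, [/\ clopen P, antisymmetric_set P & forall x, L x -> covers P x].
Proof.
move=> cL L1.
apply: (@compact_ind _ L (fun L => exists P, [/\ clopen P, antisymmetric_set P
  & forall x, L x -> covers P x])) => //.
- by exists set0; split=> //; exact: clopen0.
- by move=> U V UV [P [cP aP VP]]; exists P; split=> // x /UV; exact: VP.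
- move=> U V [P [cP aP UP]] [W [cW aW VW]]; exists (merge P W); split.
  + exact: merge_clopen.
  + exact: merge_antisymmetric.
  + move=> x [/UP|/VW]; [exact: merge_coversl|exact: merge_coversr].
- move=> x Lx; have xV : x != x^-1.
    apply/eqP => E; apply: (@no2 x); split.
      by move=> x1; apply: L1; rewrite -x1.
    by rewrite expgSS expgS expg0 mulg1 {2}E mulgV.
  have [B [cB Bx nBx]] := zX xV.
  have cW : clopen (B `&` ~` [set y | B y^-1]).
    by apply: clopenI => //; apply: (clopenC setT); exact: clopen_invg.
  exists (B `&` ~` [set y | B y^-1]).
    by apply: open_nbhs_nbhs; split; [case: cW|].
  exists (B `&` ~` [set y | B y^-1]); split=> //; last by move=> y; left.
  by move=> y [_ nBy] [By _].
Qed.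

(** The complement of [1] is exhausted by the compact complements of the
interiors of the [V n], each of which is handled by one clopen set; merging the
resulting sequence in order gives the endpoints of the arcs issuing from [1]. *)
Lemma exists_closed_game (V : nat -> set X) : (forall n, nbhs 1 (V n)) ->
  (forall x, (forall n, V n x) -> x = 1) ->
  exists2 A : set X, game_subset A & closed A.
Proof.
move=> V1 VI.
have [W WP] : exists W : nat -> set X, forall n, [/\ clopen (W n),
    antisymmetric_set (W n) & forall x, ~ (V n)° x -> covers (W n) x].
  have /choice [W WP] : forall n, exists W, [/\ clopen W, antisymmetric_set W &
      forall x, ~ (V n)° x -> covers W x].
    move=> n; apply: (@compact_antisymmetric_cover (~` (V n)°)).
      apply: closed_compactT => //.
      by apply: open_closedC; exact: open_interior.
    by apply; exact: nbhs_singleton (nbhs_interior (V1 n)).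
  by exists W.
pose P := fix P n := if n is m.+1 then merge (P m) (W m) else set0.
have cP n : clopen (P n).
  elim: n => [|n IHn]; first exact: clopen0.
  by apply: merge_clopen => //; have [] := WP n.
have aP n : antisymmetric_set (P n).
  elim: n => [//|n IHn]; by apply: merge_antisymmetric => //; have [] := WP n.
have leP m n x : (m <= n)%N -> P m x -> P n x.
  by move=> /subnK <-; elim: (n - m)%N => // k IHk Px; left; exact: IHk.
pose Q := \bigcup_n P n.
have oQ : open Q by apply: bigcup_open => n _; case: (cP n).
have aQ : antisymmetric_set Q.
  move=> x [m _ Pm] [n _ Pn]; apply: (aP (maxn m n) x).
    exact: leP (leq_maxl _ _) Pm.
  exact: leP (leq_maxr _ _) Pn.
have Q1 : ~ Q 1 by move=> Q1; apply: (aQ _ Q1); rewrite invg1.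
have QX x : x <> 1 -> covers Q x.
  move=> x1; have [n nVx] : exists n, ~ (V n)° x.
    apply: contrapT => nex; apply/x1/VI => n; apply: contrapT => nVx.
    by apply: nex; exists n => /interior_subset.
  have [_ _ /(_ _ nVx)] := WP n.
  by move=> /(@merge_coversr (P n)) [Px|Px]; [left|right]; exists n.+1.
exists (~` [set x | Q x^-1]); last exact/open_closedC/open_invg.
split; apply/seteqP; split=> x //=.
- move=> [nQx [y nQy yx]]; apply: contrapT => /QX [Qx|//].
  by apply: nQy; rewrite yx.
- move=> ->; split; first by rewrite invg1.
  by exists 1; rewrite invg1.
- move=> _; have [Qx|nQx] := pselect (Q x^-1); last by left.
  right; exists x^-1; last by rewrite invgK.
  by rewrite invgK => Qx'; exact: aQ Qx' Qx.
Qed.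

(** * Metrizability of zero-dimensional compact groups *)

(** Two elements are related when no left translate of [B] separates them.
Compactness of the group of translations makes the classes open; the translation
by [x^-1] separates [x] from every [y] with [x^-1 * y] outside [B], provided
[1] is in [B]. *)
Lemma clopen_translates_open (B : set X) x : clopen B ->
  nbhs x [set y | forall z, B (z * x) <-> B (z * y)].
Proof.
move=> cB.
have : exists2 U, nbhs x U &
    forall y, U y -> forall z, [set: X] z -> (B (z * x) <-> B (z * y)).
  apply: (@compact_ind _ [set: X] (fun L => exists2 U, nbhs x U &
    forall y, U y -> forall z, L z -> (B (z * x) <-> B (z * y)))) => //.
  - by exists setT => //; exact: filterT.
  - by move=> L M LM [U Ux UM]; exists U => // y Uy z /LM; exact: UM.
  - move=> L M [U Ux UL] [V Vx VM]; exists (U `&` V); first exact: filterI.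
    by move=> y [Uy Vy] z [Lz|Mz]; [exact: UL|exact: VM].
  - move=> z _; have : exists C, [/\ clopen C, C (z * x) &
        forall a b, C a -> C b -> (B a <-> B b)].
      have [Bzx|nBzx] := pselect (B (z * x)); [exists B|exists (~` B)];
        split=> //.
      exact: (clopenC setT).
    move=> [C [[oC _] Czx CB]].
    have : nbhs (z * x) C by exact: open_nbhs_nbhs.
    move=> /near_mulg [V [U [Vz Ux VU]]]; exists V => //.
    exists U => // y Uy v Vv.
    by apply: CB; apply: VU => //; exact: nbhs_singleton.
by move=> [U Ux UB]; apply: filterS Ux => y Uy z; exact: UB.
Qed.

Lemma zero_dimensional_metrizable (K : realType) (V : nat -> set X) :
  hausdorff_space X -> (forall n, nbhs 1 (V n)) ->
  (forall x, (forall n, V n x) -> x = 1) -> metrizable K X.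
Proof.
move=> hX V1 VI.
have /choice [B BP] : forall n, exists B, [/\ clopen B, B 1 & B `<=` V n].
  move=> n; have [B [B1 cB] BV] := zero_dimensional_cvg hX zX cX (V1 n).
  by exists B.
pose E n x y := forall z, B n (z * x) <-> B n (z * y).
apply: (@separating_equivalences_metrizable K X E) => //.
- by move=> n x y Exy z; apply: iff_sym.
- by move=> n x y z Exy Eyz w; apply: iff_trans (Exy w) (Eyz w).
- by move=> n x; apply: clopen_translates_open; have [] := BP n.
- move=> x y Exy; have /mulg1_eq : x^-1 * y = 1; last by rewrite invgK.
  apply: VI => n; have [_ B1 BV] := BP n; apply: BV.
  by apply/(Exy n); rewrite mulVg.
Qed.

End topological_groups.

(** * The theorem *)

Theorem theorem1p3 (K : realType) (X : topologicalGroupType)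
    (X_infinite : infinite_set [set: X])
    (X_compact : compact [set: X])
    (X_hausdorff : hausdorff_space X)
    (X_no_order_two : forall x : X, ~ order_two x) :
  (((exists2 A : set X, game_subset A & closed A) <->
      (totally_disconnected [set: X] /\ metrizable K X)) /\
   ((totally_disconnected [set: X] /\ metrizable K X) <-> cantor_set K X))
  /\
  (forall A : set X, game_subset A -> closed A ->
     arc_cyclic (game_tournament A) /\
     (forall x : X, cycle_point (game_tournament A) x)).
Proof.
split; [split; split|].
- move=> [A gA cA].
  have tX := game_totally_disconnected X_compact gA cA; split=> //.
  have [V [V1 VI]] := game_countable_nbhs1 X_compact gA cA X_infinite.
  have zX := totally_disconnected_zero_dimensional X_compact X_hausdorff tX.
  exact: (@zero_dimensional_metrizable _ X_compact zX K V).
- move=> [tX mX]; have [V [V1 VI]] := metrizable_countable_nbhs 1%g mX.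
  have zX := totally_disconnected_zero_dimensional X_compact X_hausdorff tX.
  exact: exists_closed_game V1 VI.
- move=> [tX mX]; split=> //; first by exists 1%g.
  exact: isolated_infinite.
- by case.
- move=> A gA cA; split=> [|x]; first exact: game_arc_cyclic.
  exact: game_cycle_point.
Qed.
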